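(* Let $\psi$ be an infinite cardinal. Every $\psi$-hard metric space $(X,d)$ is isometric to a closed subset of some algebraically $\psi$-dimensional Euclidean space $E$. However, no $\psi$-hard metric space may be isometrically embedded into any algebraically $\sigma$-dimensional Euclidean space $F$ for any cardinal $\sigma < \psi$.
   Context: For $p \ge 0$, a metric space $(X,d)$ has $p$-negative type if for all finite subsets $\{x_1, \ldots, x_n\} \subseteq X$ (with $x_1,\ldots,x_n$ distinct) and all real numbers $\eta_1, \ldots, \eta_n$ with $\eta_1 + \cdots + \eta_n = 0$ we have $\sum_{1 \le i,j \le n} d(x_i,x_j)^p \eta_i \eta_j \le 0$. A metric space is called $\psi$-hard if it has infinite cardinality $\psi$ and has $p$-negative type for some $p > 2$. A Euclidean space here means a real inner product space (not necessarily complete), with the metric induced by its inner product; its algebraic dimension is its dimension as a real vector space, i.e. the cardinality of a Hamel basis. *)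

(* Defs.v *)
From HB Require Import structures.
From mathcomp Require Import all_boot all_order all_algebra sesquilinear.
From mathcomp Require Import all_classical all_reals all_analysis.

Set Implicit Arguments.
Unset Strict Implicit.
Unset Printing Implicit Defensive.

Import Order.TTheory GRing.Theory Num.Theory.
Import numFieldNormedType.Exports.

Local Open Scope classical_set_scope.
Local Open Scope card_scope.
Local Open Scope ring_scope.

(* Cardinals: a cardinal is represented by a type K, of which it is the
   cardinality; "T has cardinality K" is [set: T] #= [set: K]. *)

Definition card_lt (K L : Type) : Prop :=
  [set: K] #<= [set: L] /\ [set: K] #!= [set: L].

Definition negative_type (R : realType) (p : R) (X : metricType R) : Prop :=
  forall (n : nat) (x : 'I_n -> X) (eta : 'I_n -> R),
    injective x -> \sum_i eta i = 0 ->
    \sum_i \sum_j mdist (x i) (x j) `^ p * eta i * eta j <= 0.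

Definition hard (R : realType) (psi : Type) (X : metricType R) : Prop :=
  [/\ infinite_set [set: psi], [set: X] #= [set: psi] &
      exists2 p : R, 2 < p & negative_type p X].

(* A real inner product space: its norm, hence its distance `|x - y| and its
   topology, are those of the inner product. Completeness is not required. *)
Record euclideanType (R : realType) := Euclidean {
  euclidean_sort :> normedModType R;
  inner : {dot euclidean_sort for idfun};
  euclidean_normE : forall x : euclidean_sort,
    `|x| = Num.sqrt (inner x x)
}.

Definition linearly_independent (R : realType) (E : lmodType R)
    (B : set E) : Prop :=
  forall (n : nat) (v : 'I_n -> E) (c : 'I_n -> R),
    injective v -> (forall i, B (v i)) ->
    \sum_i c i *: v i = 0 -> forall i, c i = 0.

Definition spanning (R : realType) (E : lmodType R) (B : set E) : Prop :=
  forall x : E, exists (n : nat) (v : 'I_n -> E) (c : 'I_n -> R),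
    (forall i, B (v i)) /\ x = \sum_i c i *: v i.

Definition hamel_basis (R : realType) (E : lmodType R) (B : set E) : Prop :=
  linearly_independent B /\ spanning B.

Definition algebraic_dimension (R : realType) (E : lmodType R) (K : Type) :
    Prop :=
  exists2 B : set E, hamel_basis B & B #= [set: K].

Definition isometric_embedding (R : realType) (X : metricType R)
    (E : euclideanType R) (f : X -> E) : Prop :=
  forall x y : X, `|f x - f y| = mdist x y.

(* Main.v *)
From HB Require Import structures.
Require Import Defs.
From mathcomp Require Import all_boot all_order all_algebra.
From mathcomp Require Import perm finmap.
From mathcomp Require Import all_classical all_reals all_analysis.
From mathcomp Require Import ring lra.

(** The theorem rests on a strictness phenomenon: if a metric [d] has p-negative
type for some [p > 2], then [\sum d(x_i, x_j)^2 c_i c_j < 0] whenever the points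
are distinct and the coefficients are not all zero and have sum zero.

Strictness. Since [d^2 = (d^p)^a] with [a = 2 / p < 1], it is enough to show that
raising a conditionally negative kernel to a power [a < 1] makes it strictly
negative ([cnd_powR_lt0]). The binomial series of [(1 - x) ^ a] is [1] minus a
power series with nonnegative coefficients, and entrywise powers of a positive
kernel are positive by Schur's product theorem ([psd_exp]). Hence, if
[x = 1 - A / M] is a positive kernel, every truncation of the series is negative
on coefficients of sum zero, while it differs from [(1 - x) ^ a = (A / M) ^ a]
by the tail of the coefficients on the diagonal and by much less off the
diagonal ([binom_trunc_approx], [qform_powR_subr]). Positivity of
[1 - A / M] is obtained by adding a small [e] to [A] off the diagonal and taking
[M] large ([psd_of_cnd]). About [T * M] terms of the series suffice, and the tail
is then at least a constant times [(T * M) ^ (- a)]; this compensates the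
factor [M ^ a], so the bound does not depend on [e], which can tend to [0].

Affine independence. In an inner product space, for coefficients of sum zero,
the form of the squared distances is [- 2 * |\sum c_i y_i| ^ 2]
([qform_sqr_dist]). Strictness therefore says that any isometric copy of such a
metric space is affinely independent ([affinely_independent]).

Embedding. By strictness, the law of cosines with base point [x0] gives a
strictly positive kernel on [X] ([dist_kernel_spd]), that is, an inner product on
the finitely supported functions on [X]; the basis formed by the point masses is
an isometric copy of [X], and has the cardinality of [X]. A limit of basis
vectors outside the basis would extend [X] by one point without losing
p-negative type ([limit_cnd]), although it is an affine combination of basis
vectors; so the basis is closed ([closed_isometric_range]).

Lower bound on the dimension. An isometric copy of [X] in a Euclidean space is
affinely independent, so it provides a linearly independent family indexed by
[X]. Such a family injects into any spanning set
([linear_independent_injection]): for finite subfamilies a nonzero minor selects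
the injection, and an ultrafilter glues these selections. *)

Set Implicit Arguments.
Unset Strict Implicit.
Unset Printing Implicit Defensive.

Import Order.TTheory GRing.Theory Num.Theory.
Import numFieldNormedType.Exports.

Local Open Scope classical_set_scope.
Local Open Scope card_scope.
Local Open Scope ring_scope.

Lemma sum_option (V : nmodType) (I : finType) (F : option I -> V) :
  \sum_o F o = F None + \sum_i F (Some i).
Proof.
rewrite (bigD1 None)//=; congr (_ + _).
rewrite (reindex_omap Some id)/=; last by case.
by apply: eq_bigl => i; rewrite eqxx.
Qed.

(** * Positive and conditionally negative kernels *)

Section QuadraticForms.
Variables (R : realFieldType) (I : finType).
Implicit Types (A B : I -> I -> R) (v : I -> R).

Definition qform A v : R := \sum_i \sum_j A i j * v i * v j.

Definition symmetric_kernel A := forall i j, A i j = A j i.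

Definition psd A := forall v, 0 <= qform A v.

Definition cnd A := forall v, \sum_i v i = 0 -> qform A v <= 0.

Lemma sum_delta (F : I -> R) i : \sum_j F j * (j == i)%:R = F i.
Proof.
by rewrite (bigD1 i)//= eqxx mulr1 big1 ?addr0// => j /negPf ->; rewrite mulr0.
Qed.

Lemma qformE A v : qform A v = \sum_i v i * \sum_j A i j * v j.
Proof.
by apply: eq_bigr => i _; rewrite mulr_sumr; apply: eq_bigr => j _; ring.
Qed.

Lemma qform_shift A v i t : symmetric_kernel A ->
  qform A (fun j => v j + t * (j == i)%:R) =
  qform A v + 2 * t * (\sum_j A i j * v j) + t ^+ 2 * A i i.
Proof.
move=> Asym; rewrite !qformE.
transitivity (\sum_j (v j * (\sum_k A j k * v k) + t * (A i j * v j) +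
    (t * (\sum_k A j k * v k) + t ^+ 2 * A j i) * (j == i)%:R)).
  apply: eq_bigr => j _.
  have -> : \sum_k A j k * (v k + t * (k == i)%:R) =
            \sum_k A j k * v k + t * A j i.
    rewrite -[in RHS](sum_delta (A j) i) mulr_sumr -big_split/=.
    by apply: eq_bigr => k _; ring.
  by rewrite (Asym i j); ring.
by rewrite !big_split/= sum_delta -mulr_sumr; ring.
Qed.

Lemma psd_diag_ge0 A i : symmetric_kernel A -> psd A -> 0 <= A i i.
Proof.
move=> Asym /(_ (fun j => 0 + 1 * (j == i)%:R)); rewrite qform_shift//.
have -> : qform A (fun=> 0) = 0.
  by rewrite /qform big1// => k _; rewrite big1// => l _; rewrite mulr0.
by rewrite big1 ?mulr0 ?add0r ?expr1n ?mul1r// => k _; rewrite mulr0.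
Qed.

Lemma psd_diag0 A i j : symmetric_kernel A -> psd A -> A i i = 0 -> A i j = 0.
Proof.
move=> Asym Apsd Aii.
have H t : 0 <= A j j + 2 * t * A i j.
  have := Apsd (fun k => (0 + 1 * (k == j)%:R) + t * (k == i)%:R).
  rewrite !qform_shift// Aii.
  have -> : qform A (fun=> 0) = 0.
    by rewrite /qform big1// => k _; rewrite big1// => l _; rewrite mulr0.
  rewrite [X in 2 * 1 * X]big1; last by move=> k _; rewrite mulr0.
  under eq_bigr do rewrite add0r mul1r.
  by rewrite sum_delta; lra.
apply/eqP/negPn/negP => Aij0.
have := H (- (A j j + 1) / (2 * A i j)).
have -> : 2 * (- (A j j + 1) / (2 * A i j)) * A i j = - (A j j + 1) by field.
by lra.
Qed.

(** One step of symmetric Gaussian elimination: subtracting the rank one kernel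
    that agrees with [A] on row [i] stays positive because it amounts to
    minimising the form in the direction [i]. *)
Lemma psd_eliminate A i : symmetric_kernel A -> psd A -> 0 < A i i ->
  psd (fun j k => A j k - A i j * A i k / A i i).
Proof.
move=> Asym Apsd Aii v.
set s := \sum_j A i j * v j.
have := Apsd (fun j => v j + (- s / A i i) * (j == i)%:R).
rewrite qform_shift// -/s.
suff -> : qform (fun j k => A j k - A i j * A i k / A i i) v =
   qform A v + 2 * (- s / A i i) * s + (- s / A i i) ^+ 2 * A i i by [].
rewrite !qformE.
transitivity (\sum_j (v j * (\sum_k A j k * v k) +
                      (A i j * v j) * (- s / A i i))).
  apply: eq_bigr => j _.
  have -> : \sum_k (A j k - A i j * A i k / A i i) * v k =
     \sum_k A j k * v k + (- (A i j / A i i)) * s.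
    by rewrite /s mulr_sumr -big_split/=; apply: eq_bigr => k _; ring.
  by ring.
rewrite big_split/= -mulr_suml -/s.
by field; rewrite gt_eqF.
Qed.

(** Eliminate the rows of [A] one at a time: each eliminated rank one part pairs
    with [B] to a value of the form of [B]. *)
Lemma psd_pairing_ge0 A B : symmetric_kernel A -> psd A -> psd B ->
  0 <= \sum_i \sum_j A i j * B i j.
Proof.
move=> + + Bpsd.
have [n] := ubnP #|[pred i | A i i != 0]|; elim: n A => // n IHn A leAn Asym Apsd.
have [/existsP[i Aii]|/existsPn A0] := boolP [exists i, A i i != 0]; last first.
  rewrite big1// => i _; rewrite big1// => j _.
  have /negPn/eqP Aii := A0 i.
  by rewrite (psd_diag0 _ Asym Apsd Aii) mul0r.
have Aigt0 : 0 < A i i by rewrite lt_neqAle eq_sym Aii psd_diag_ge0.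
pose A' j k := A j k - A i j * A i k / A i i.
have -> : \sum_j \sum_k A j k * B j k =
    \sum_j \sum_k A' j k * B j k + qform B (A i) / A i i.
  rewrite /qform mulr_suml -big_split/=; apply: eq_bigr => j _.
  rewrite mulr_suml -big_split/=; apply: eq_bigr => k _.
  by rewrite /A'; field.
apply: addr_ge0; last by rewrite divr_ge0// ?ltW.
apply: IHn; last exact: psd_eliminate; last first.
  by move=> j k; rewrite /A' (Asym j k); ring.
rewrite -ltnS (leq_trans _ leAn)// ltnS; apply: proper_card.
apply/fintype.properP; split; last first.
  by exists i; rewrite !inE// /A' mulfK// subrr eqxx.
apply/fintype.subsetP => j; rewrite !inE; apply: contraNN => /eqP Ajj.
by rewrite /A' Ajj Asym (psd_diag0 _ Asym Apsd Ajj) mul0r mul0r subrr.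
Qed.

(** Schur's product theorem. *)
Lemma psd_mul A B : symmetric_kernel A -> psd A -> psd B ->
  psd (fun i j => A i j * B i j).
Proof.
move=> Asym Apsd Bpsd v.
pose B' i j := B i j * v i * v j.
have B'psd : psd B'.
  move=> w; have := Bpsd (fun i => w i * v i); rewrite /qform /B'.
  congr (0 <= _); apply: eq_bigr => i _; apply: eq_bigr => j _; ring.
have := psd_pairing_ge0 Asym Apsd B'psd; rewrite /qform /B'.
by under eq_bigr do under eq_bigr do rewrite !mulrA.
Qed.

Lemma psd_exp A n : symmetric_kernel A -> psd A ->
  psd (fun i j => A i j ^+ n.+1).
Proof.
move=> Asym Apsd; elim: n => [|n IHn].
  move=> v; rewrite /qform.
  by under eq_bigr do under eq_bigr do rewrite expr1; exact: Apsd.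
move=> v; have := psd_mul Asym Apsd IHn v.
by rewrite /qform; under eq_bigr do under eq_bigr do rewrite -exprS.
Qed.

(** Moving the sum [s] of the coefficients [v] onto a single index [i0] gives
    coefficients of sum zero, on which [A] is negative. This leaves cross terms
    [2 * s * A i0 j * v j], which the strict perturbation [e] and the large
    constant [M] absorb by completing squares. *)
Lemma psd_of_cnd A e : symmetric_kernel A -> (forall i, A i i = 0) -> cnd A ->
  0 < e -> exists M0, forall M, M0 <= M -> 0 < M ->
    psd (fun i j => 1 - (A i j + e * (i != j)%:R) / M).
Proof.
move=> Asym A0 Acnd e0.
have [i0 _|I0] := pickP (@predT I); last first.
  by exists 0 => M _ _ v; rewrite /qform big1// => i; have := I0 i.
exists (e + (\sum_j A i0 j ^+ 2) / e) => M M0M M0 v.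
set s := \sum_j v j.
have cross : qform A v <= 2 * s * \sum_j A i0 j * v j.
  have := Acnd (fun j => v j + (- s) * (j == i0)%:R).
  rewrite big_split/= -/s (sum_delta (fun=> - s)) subrr => /(_ erefl).
  by rewrite qform_shift// A0; lra.
have young : 2 * s * (\sum_j A i0 j * v j) <=
    e * (\sum_j v j ^+ 2) + s ^+ 2 * (\sum_j A i0 j ^+ 2) / e.
  rewrite [leLHS]mulr_sumr [X in X + _]mulr_sumr [X in _ + X / _]mulr_sumr.
  rewrite [X in _ + X]mulr_suml -big_split/=; apply: ler_sum => j _.
  rewrite -subr_ge0.
  have -> : e * v j ^+ 2 + s ^+ 2 * A i0 j ^+ 2 / e - 2 * s * (A i0 j * v j) =
    (e * v j - s * A i0 j) ^+ 2 / e by field; rewrite gt_eqF.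
  by rewrite divr_ge0 ?sqr_ge0// ltW.
have -> : qform (fun i j => 1 - (A i j + e * (i != j)%:R) / M) v =
    s ^+ 2 - (qform A v + e * (s ^+ 2 - \sum_j v j ^+ 2)) / M.
  have s2 : s ^+ 2 = \sum_i \sum_j v i * v j.
    by rewrite expr2 mulr_suml; apply: eq_bigr => i _; rewrite mulr_sumr.
  have d2 : \sum_j v j ^+ 2 = \sum_i \sum_j (v i * v j) * (j == i)%:R.
    by apply: eq_bigr => i _; rewrite sum_delta expr2.
  rewrite s2 d2 /qform -sumrB mulr_sumr -big_split/= mulr_suml -sumrB.
  apply: eq_bigr => i _.
  rewrite -sumrB mulr_sumr -big_split/= mulr_suml -sumrB.
  apply: eq_bigr => j _; rewrite (eq_sym i).
  by case: (j == i) => /=; ring.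
rewrite subr_ge0 ler_pdivrMr//.
have : s ^+ 2 * (e + (\sum_j A i0 j ^+ 2) / e) <= s ^+ 2 * M.
  by rewrite ler_wpM2l ?sqr_ge0.
by lra.
Qed.

End QuadraticForms.

(** * Truncations of the binomial series *)

Section BinomialApproximation.
Variables (R : realType) (a : R).
Hypothesis a01 : 0 < a < 1.

(** If [(1 - x) ^ a = 1 - \sum_k c k * x ^ k.+1], then [binom_tail n] is
    [1 - \sum_(k < n) c k]; it is also the coefficient of [x ^ n] in
    [(1 - x) ^ (a - 1)]. *)
Definition binom_tail n : R := \prod_(k < n) (1 - a / k.+1%:R).

(** The Taylor polynomial of [(1 - x) ^ a], its coefficients being written as
    differences of consecutive tails. *)
Definition binom_trunc n (x : R) : R :=
  1 - \sum_(k < n) (binom_tail k - binom_tail k.+1) * x ^+ k.+1.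

Lemma binom_tailS n : binom_tail n.+1 = binom_tail n * (1 - a / n.+1%:R).
Proof. by rewrite /binom_tail big_ord_recr. Qed.

Lemma binom_tail_ge0 n : 0 <= binom_tail n.
Proof.
apply: prodr_ge0 => k _; rewrite subr_ge0 ler_pdivrMr// mul1r.
by have /andP[_ /ltW a1] := a01; rewrite (le_trans a1)// ler1n.
Qed.

(** Young's inequality in the form [y `^ a <= a * y + (1 - a)]. *)
Lemma powR_le_line (y : R) : 0 <= y -> y `^ a <= 1 - a * (1 - y).
Proof.
move=> y0; have /andP[a0 a1] := a01.
have a1' : 0 < 1 - a by lra.
have := @conjugate_powR _ (y `^ a) 1 a^-1 (1 - a)^-1 (powR_ge0 _ _) ler01.
rewrite !invr_gt0 !invrK powR1 -powRrM mulfV ?gt_eqF// powRr1// mulr1 => /(_ a0 a1').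
by rewrite addrC subrK => /(_ erefl); lra.
Qed.

(** The tail decays no faster than [n ^ (- a)]: each factor [1 - a / k] is at
    least [((k - 1) / k) ^ a], and these telescope. *)
Lemma binom_tail_lower n : (1 - a) * n.+1%:R `^ (- a) <= binom_tail n.+1.
Proof.
have /andP[a0 a1] := a01; elim: n => [|n IHn].
  by rewrite powR1 mulr1 /binom_tail big_ord1 divr1.
rewrite binom_tailS.
have -> : (n.+2%:R : R) `^ (- a) =
    n.+1%:R `^ (- a) * (n.+1%:R / n.+2%:R) `^ a.
  rewrite powRM// ?invr_ge0// mulrA -powRD; last by rewrite pnatr_eq0 implybT.
  by rewrite addNr powRr0 mul1r -powR_inv1// -powRrM mulN1r.
rewrite mulrA ler_pM ?powR_ge0 ?mulr_ge0 ?powR_ge0//; first by lra.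
apply: le_trans (powR_le_line _) _; first by rewrite divr_ge0.
rewrite le_eqVlt; apply/orP; left; apply/eqP.
rewrite [n.+2%:R]mulrSr; field.
by rewrite -(natrD _ 1) -mulrSr pnatr_eq0.
Qed.

Lemma binom_tail_sub n :
  binom_tail n - binom_tail n.+1 = binom_tail n * (a / n.+1%:R).
Proof. by rewrite binom_tailS; ring. Qed.

Lemma binom_trunc1 n : binom_trunc n 1 = binom_tail n.
Proof.
rewrite /binom_trunc; elim: n => [|n IHn].
  by rewrite big_ord0 /binom_tail big_ord0 subr0.
by rewrite big_ord_recr/= expr1n mulr1 opprD addrA IHn; ring.
Qed.

(* The Taylor polynomial of [(1 - x) ^ (a - 1)]. *)
Let psum n (x : R) : R := \sum_(k < n) binom_tail k * x ^+ k.

Lemma binom_truncE n x :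
  binom_trunc n x = (1 - x) * psum n x + binom_tail n * x ^+ n.
Proof.
rewrite /binom_trunc /psum; elim: n => [|n IHn].
  by rewrite !big_ord0 /binom_tail big_ord0; ring.
by rewrite !big_ord_recr/= opprD addrA IHn exprS; ring.
Qed.

Let dpsum n (x : R) : R := \sum_(k < n) binom_tail k * (k%:R * x ^+ k.-1).

(** [(1 - x) ^ (a - 1)] satisfies this differential equation with right-hand
    side [0]; truncation leaves a single term, whose sign is known. *)
Lemma psum_ode n x :
  (1 - x) * dpsum n x -
  (1 - a) * psum n x = - (n%:R * binom_tail n * x ^+ n.-1).
Proof.
rewrite /psum /dpsum; elim: n => [|n IHn]; first by rewrite !big_ord0; ring.
rewrite !big_ord_recr/= 2!mulrDr opprD addrACA IHn binom_tailS.
case: n {IHn} => [|n]/=; first by rewrite divr1; ring.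
by rewrite exprS [n.+2%:R]mulrSr; field; rewrite -(natrD _ 1) -mulrSr pnatr_eq0.
Qed.

Lemma is_derive_psum n (x : R) : is_derive x (1 : R) (psum n) (dpsum n x).
Proof.
have -> : psum n = \sum_(k < n) binom_tail k *: (@id R) ^+ k.
  by apply/funext => y; rewrite fct_sumE; apply: eq_bigr => k _; rewrite fctE.
by apply: is_derive_eq; apply: eq_bigr => k _; rewrite /GRing.scale/= mulr1.
Qed.

(** A differential inequality bounds a function by the power it would be if
    the inequality were an equality: [f t * (1 - t) `^ (- b)] is monotone. *)
Lemma powR_compare (f df : R -> R) (b c x : R) : 0 <= x < 1 ->
  (forall t : R, is_derive t (1 : R) f (df t)) ->
  (forall t, 0 < t < 1 -> 0 <= c * ((1 - t) * df t + b * f t)) ->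
  0 <= c * (f x - f 0 * (1 - x) `^ b).
Proof.
move=> /andP[x0 x1] fd ode.
have := x0; rewrite le_eqVlt => /predU1P[<-|{}x0].
  by rewrite subr0 powR1 mulr1 subrr mulr0.
pose g (t : R) := f t * (1 - t) `^ (- b).
pose dg (t : R) := (1 - t) `^ (- b - 1) * ((1 - t) * df t + b * f t).
have gd (t : R) : t < 1 -> is_derive t (1 : R) g (dg t).
  move=> t1; have t1' : 0 < 1 - t by lra.
  have pd : is_derive t (1 : R) (fun s => (1 - s) `^ (- b))
      (b * (1 - t) `^ (- b - 1)).
    have ld : is_derive t (1 : R) (fun s => 1 - s) (-1).
      have -> : (fun s : R => 1 - s) = cst 1 - id by [].
      by apply: is_derive_eq; rewrite sub0r.
    have := @is_derive1_comp R (fun s => s `^ (- b)) (fun s => 1 - s) t _ _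
      (is_derive1_powR (- b) t1') ld.
    by move=> H; apply: is_derive_eq; rewrite mulrN1 mulNr opprK.
  have fdt := fd t.
  apply: is_derive_eq; rewrite /dg /GRing.scale/=.
  have -> : (1 - t) `^ (- b) = (1 - t) * (1 - t) `^ (- b - 1).
    rewrite -[X in X * _]powRr1 ?ltW// -powRD ?(gt_eqF t1') ?implybT//.
    by congr (_ `^ _); ring.
  by ring.
have gi t : t \in `]0, x[ -> is_derive t (1 : R) g (dg t).
  by rewrite in_itv/= => /andP[_ tx]; apply: gd; lra.
have [|t + gx] := @MVT R g dg 0 x x0 gi.
  apply: derivable_within_continuous => t; rewrite in_itv/= => /andP[_ tx].
  by have [] : is_derive t (1 : R) g (dg t) by apply: gd; lra.
rewrite in_itv/= => /andP[t0 tx].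
have xb : 0 < (1 - x) `^ b by rewrite powR_gt0 ?subr_gt0.
have -> : c * (f x - f 0 * (1 - x) `^ b) = (c * (g x - g 0)) * (1 - x) `^ b.
  rewrite /g subr0 powR1 mulr1 powRN; field; exact: lt0r_neq0.
rewrite mulr_ge0 ?(ltW xb)// gx subr0 /dg mulrA mulr_ge0 ?(ltW x0)//.
rewrite mulrCA mulr_ge0 ?powR_ge0// ode//; lra.
Qed.

(** By [binom_truncE] the truncation exceeds [1 - x] times the truncation of
    [(1 - x) ^ (a - 1)] by the claimed error, and the power lies between the two:
    each bound compares a polynomial with the solution of the differential
    equation that it nearly satisfies. *)
Lemma binom_trunc_approx n (x : R) : 0 <= x < 1 ->
  `|(1 - x) `^ a - binom_trunc n x| <= binom_tail n * x ^+ n.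
Proof.
move=> x01; have /andP[x0 x1] := x01; have /andP[a0 a1] := a01.
have tail_ge0 m t : 0 <= t -> 0 <= binom_tail n * t ^+ m.
  by move=> ?; rewrite mulr_ge0 ?binom_tail_ge0// exprn_ge0.
have lower : (1 - x) * psum n x <= (1 - x) `^ a.
  rewrite -(@mulr_powRB1 _ (1 - x) a)//; last by lra.
  rewrite ler_wpM2l//; first by lra.
  case: n tail_ge0 => [|n] tail_ge0; first by rewrite /psum big_ord0 powR_ge0.
  have psum0 : psum n.+1 0 = 1.
    rewrite /psum big_ord_recl/= expr0 mulr1 big1 ?addr0 => [|k _].
      by rewrite /binom_tail big_ord0.
    by rewrite expr0n mulr0.
  have := @powR_compare (psum n.+1) (dpsum n.+1) (a - 1) (-1) x x01 (is_derive_psum n.+1).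
  rewrite psum0 mul1r mulN1r oppr_ge0 subr_le0; apply => t /andP[t0 t1].
  have -> : a - 1 = - (1 - a) by ring.
  rewrite mulN1r [- (1 - a) * _]mulNr psum_ode opprK -mulrA mulr_ge0//.
  by rewrite tail_ge0// ltW.
have upper : (1 - x) `^ a <= binom_trunc n x.
  have fd (t : R) : is_derive t (1 : R) (binom_trunc n)
    (- psum n t + (1 - t) * dpsum n t
      + n%:R * binom_tail n * t ^+ n.-1).
    have -> : binom_trunc n = (cst 1 - id) * psum n + binom_tail n *: (@id R) ^+ n.
      by apply/funext => y; rewrite binom_truncE !fctE.
    have gd := is_derive_psum n t.
    have ld : is_derive t (1 : R) (cst 1 - id) (-1).
      by apply: is_derive_eq; rewrite sub0r.
    have pd : is_derive t (1 : R) ((@id R) ^+ n) (n%:R * t ^+ n.-1).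
      by apply: is_derive_eq; rewrite /GRing.scale/= mulr1.
    have := is_deriveD (is_deriveM ld gd) (is_deriveZ (binom_tail n) pd).
    move/is_derive_eq; apply; rewrite /GRing.scale.
    have -> : (cst 1 - id : R -> R) t = 1 - t by [].
    by move: (dpsum n t) (psum n t) => D G /=; ring.
  have := powR_compare (b := a) (c := 1) x01 fd.
  have -> : binom_trunc n 0 = 1.
    by rewrite /binom_trunc big1 ?subr0// => k _; rewrite expr0n mulr0.
  rewrite !mul1r subr_ge0; apply => t /andP[t0 t1].
  rewrite mul1r binom_truncE.
  have := psum_ode n t.
  set G := dpsum n t; set g := psum n t => ode.
  have -> : (1 - t) * (- g + (1 - t) * G + n%:R * binom_tail n * t ^+ n.-1) +
     a * ((1 - t) * g + binom_tail n * t ^+ n) =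
     (1 - t) * ((1 - t) * G - (1 - a) * g + n%:R * binom_tail n * t ^+ n.-1)
      + a * (binom_tail n * t ^+ n) by ring.
  by rewrite ode addNr mulr0 add0r mulr_ge0 ?tail_ge0// ltW.
rewrite distrC ger0_norm ?subr_ge0// lerBlDr addrC -lerBlDr.
by rewrite {1}binom_truncE addrK.
Qed.

End BinomialApproximation.

(** * Powers of conditionally negative kernels *)

Section PowersOfNegativeKernels.
Variables (R : realType) (I : finType) (a : R).
Hypothesis a01 : 0 < a < 1.
Implicit Types (A : I -> I -> R) (v : I -> R).

Lemma qform_const v : qform (fun _ _ => 1) v = (\sum_i v i) ^+ 2.
Proof.
rewrite expr2 mulr_suml; apply: eq_bigr => i _; rewrite mulr_sumr.
by apply: eq_bigr => j _; rewrite mul1r.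
Qed.

(** The constant term of the truncation contributes the squared sum of the
    coefficients, which is [0], and each further term is minus a positive
    kernel. *)
Lemma qform_binom_trunc_le0 A v n : symmetric_kernel A -> psd A ->
  \sum_i v i = 0 -> qform (fun i j => binom_trunc a n (A i j)) v <= 0.
Proof.
move=> Asym Apsd v0.
have -> : qform (fun i j => binom_trunc a n (A i j)) v =
    qform (fun _ _ => 1) v - \sum_(k < n)
      (binom_tail a k - binom_tail a k.+1) * qform (fun i j => A i j ^+ k.+1) v.
  under [in RHS]eq_bigr do rewrite mulr_sumr.
  rewrite exchange_big -sumrB; apply: eq_bigr => i _.
  under [in RHS]eq_bigr do rewrite mulr_sumr.
  rewrite exchange_big -sumrB; apply: eq_bigr => j _.
  rewrite /binom_trunc 2!mulrBl mulr_suml mulr_suml.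
  by congr (_ - _); apply: eq_bigr => k _; ring.
rewrite qform_const v0 expr0n/= sub0r oppr_le0 sumr_ge0// => k _.
rewrite mulr_ge0//; last exact: psd_exp.
rewrite binom_tail_sub mulr_ge0 ?binom_tail_ge0// divr_ge0//.
by have /andP[/ltW] := a01.
Qed.

(** The diagonal of [(1 - A) ^ a] vanishes while that of the truncation is
    [binom_tail a n], so the form of the former lies below [- binom_tail a n]
    times the squared length, up to an off-diagonal error that is small for
    large [n]. *)
Lemma qform_powR_subr A v n r : symmetric_kernel A -> psd A ->
  (forall i, A i i = 1) -> (forall i j, i != j -> 0 <= A i j <= r) -> 0 <= r < 1 ->
  \sum_i v i = 0 ->
  r ^+ n * (\sum_i \sum_j `|v i * v j|) <= (\sum_i v i ^+ 2) / 2 ->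
  qform (fun i j => (1 - A i j) `^ a) v <=
  - (binom_tail a n * (\sum_i v i ^+ 2) / 2).
Proof.
move=> Asym Apsd A1 Ar /andP[r0 r1] v0 rn; have /andP[a0 _] := a01.
have T0 := binom_tail_ge0 a01 n.
suff H : qform (fun i j => (1 - A i j) `^ a) v <=
    qform (fun i j => binom_trunc a n (A i j)) v +
    binom_tail a n * (r ^+ n * (\sum_i \sum_j `|v i * v j|)) -
    binom_tail a n * (\sum_i v i ^+ 2).
  apply: le_trans H _; have := qform_binom_trunc_le0 n Asym Apsd v0.
  by have := ler_wpM2l T0 rn; lra.
have d2 : \sum_j v j ^+ 2 = \sum_i \sum_j (v i * v j) * (j == i)%:R.
  by apply: eq_bigr => i _; rewrite sum_delta expr2.
rewrite d2 3!mulr_sumr -big_split/= -sumrB; apply: ler_sum => i _.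
rewrite 3!mulr_sumr -big_split/= -sumrB; apply: ler_sum => j _.
have [->|ji] := eqVneq j i.
  rewrite A1 subrr powR0 ?gt_eqF// binom_trunc1 !mul0r mulr1.
  have : 0 <= binom_tail a n * (r ^+ n * `|v i * v i|); last first.
    by lra.
  by rewrite !mulr_ge0 ?exprn_ge0.
rewrite mulr0 mulr0 subr0 -lerBlDl.
have /andP[A0 Ar'] : 0 <= A i j <= r by apply: Ar; rewrite eq_sym.
apply: le_trans (ler_norm _) _.
rewrite -2!mulrA -mulrBl normrM mulrA ler_wpM2r//.
apply: le_trans (binom_trunc_approx a01 n _) _; first by rewrite A0 (le_lt_trans Ar').
by rewrite ler_wpM2l// lerXn2r ?nnegrE// (le_trans A0).
Qed.

Lemma expr_onem_le (y : R) n : 0 <= y <= 1 -> (1 - y) ^+ n * (1 + n%:R * y) <= 1.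
Proof.
move=> /andP[y0 y1]; elim: n => [|n IHn]; first by rewrite expr0 mul0r addr0 mulr1.
apply: le_trans IHn; rewrite exprSr -mulrA ler_wpM2l ?exprn_ge0 ?subr_ge0//.
rewrite mulrSr -subr_ge0.
rewrite [leRHS](_ : _ = (n%:R + 1) * (y * y)); last ring.
by rewrite !mulr_ge0// addr_ge0.
Qed.

Lemma powR_addr_close (x e : R) : 0 < x -> 0 <= e ->
  `|(x + e) `^ a - x `^ a| <= e * (x `^ a / x).
Proof.
move=> x0 e0; have /andP[a0 a1] := a01.
have -> : (x + e) `^ a = x `^ a * (1 + e / x) `^ a.
  rewrite -powRM ?(ltW x0)//; last by rewrite addr_ge0// divr_ge0// ltW.
  by congr (_ `^ a); field; exact: lt0r_neq0.
have ex : 1 <= 1 + e / x by rewrite lerDl divr_ge0// ltW.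
have ub := ler1_powR ex (ltW a1).
have lb := ler_powR ex (ltW a0); rewrite powRr0 in lb.
rewrite -{2}[x `^ a]mulr1 -mulrBr ger0_norm; last first.
  by rewrite mulr_ge0 ?powR_ge0// subr_ge0.
by rewrite mulrCA ler_wpM2l ?powR_ge0// lerBlDl.
Qed.

(** The perturbation [e] gives a bound that is uniform in [e]: with a scaling
    constant [M] and about [T * M] terms of the expansion, the factor [M `^ a]
    of the scaling compensates the decay [(T * M) `^ (- a)] of the tail. *)
Lemma cnd_powR_perturbed A v : symmetric_kernel A -> (forall i, A i i = 0) ->
  (forall i j, i != j -> 0 < A i j) -> cnd A ->
  \sum_i v i = 0 -> 0 < \sum_i v i ^+ 2 ->
  exists2 c, 0 < c & forall e, 0 < e <= 1 ->
    qform (fun i j => (A i j + e * (i != j)%:R) `^ a) v <= - c.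
Proof.
move=> Asym A0 Apos Acnd v0; set q := \sum_i v i ^+ 2 => q0.
have /andP[a0 a1] := a01.
have A_ge0 i j : 0 <= A i j.
  by have [->|/Apos/ltW//] := eqVneq i j; rewrite A0.
have le_sum (F : I -> I -> R) i j : (forall i j, 0 <= F i j) ->
    F i j <= \sum_i \sum_j F i j.
  move=> F0; rewrite (bigD1 i)//= (bigD1 j)//= -addrA lerDl addr_ge0//.
    by rewrite sumr_ge0.
  by rewrite sumr_ge0// => k _; rewrite sumr_ge0.
pose C := \sum_i \sum_j A i j.
have AC i j : A i j <= C by exact: le_sum.
have C0 : 0 <= C by rewrite sumr_ge0// => i _; rewrite sumr_ge0.
(* The reciprocals, which are [0] on the diagonal, are summed to get a lower
   bound [d] of the off-diagonal entries without a minimum over a possibly empty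
   set. *)
pose D := 1 + \sum_i \sum_j (A i j)^-1.
have D1 : 1 <= D.
  by rewrite lerDl sumr_ge0// => i _; rewrite sumr_ge0// => j _; rewrite invr_ge0.
have D0 : 0 < D by lra.
pose d := D^-1; have d0 : 0 < d by rewrite invr_gt0.
have d1 : d <= 1 by rewrite invf_le1.
have Ad i j : i != j -> d <= A i j.
  move=> ij; rewrite -[A i j]invrK lef_pV2 ?posrE// ?invr_gt0 ?Apos//.
  apply: le_trans (_ : \sum_i \sum_j (A i j)^-1 <= _); last by rewrite lerDr.
  by apply: (le_sum (fun i j => (A i j)^-1)) => k l; rewrite invr_ge0.
pose S := \sum_i \sum_j `|v i * v j|.
have S0 : 0 <= S by rewrite sumr_ge0// => i _; rewrite sumr_ge0.
(* With [T * M] terms the off-diagonal error [(1 - d / M) ^+ n.+1] is at most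
   [(1 + T * d)^-1] whatever [M] is; this [T] brings it below [q / (2 * S)]. *)
pose T := 2 * S / (q * d).
have T0 : 0 <= T by rewrite divr_ge0 ?mulr_ge0// ltW.
pose k := (1 - a) * (T + 1) `^ (- a).
have k0 : 0 < k by rewrite mulr_gt0 ?powR_gt0//; lra.
exists (k * q / 2); first by rewrite divr_gt0// mulr_gt0.
move=> e /andP[e0 e1].
have [M0 psdM] := psd_of_cnd Asym A0 Acnd e0.
pose M := Num.max M0 (C + 2).
have MC : C + 2 <= M by rewrite le_max lexx orbT.
have M1 : 1 <= M by lra.
have Mgt0 : 0 < M by lra.
pose x i j := 1 - (A i j + e * (i != j)%:R) / M.
have xpsd : psd x by apply: psdM => //; rewrite le_max lexx.
have xsym : symmetric_kernel x by move=> i j; rewrite /x Asym eq_sym.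
have x1 i : x i i = 1 by rewrite /x A0 eqxx mulr0 addr0 mul0r subr0.
have dM : 0 <= d / M <= 1.
  by rewrite divr_ge0 ?(ltW d0) ?(ltW Mgt0)//= ler_pdivrMr// mul1r (le_trans d1).
have xd i j : i != j -> 0 <= x i j <= 1 - d / M.
  move=> ij; rewrite /x ij mulr1 subr_ge0 ler_pdivrMr// mul1r.
  rewrite lerD2l lerN2 ler_pM2r ?invr_gt0//.
  by have := AC i j; have := Ad _ _ ij; lra.
pose n := Num.truncn (T * M).
have TM0 : 0 <= T * M by rewrite mulr_ge0// ltW.
have /andP[nTM TMn] : n%:R <= T * M < n.+1%:R by exact: truncn_itv.
have dM01 : 0 <= 1 - d / M < 1.
  have : 0 < d / M by rewrite divr_gt0.
  by move/andP : dM => [_]; lra.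
have small : (1 - d / M) ^+ n.+1 * S <= q / 2.
  have b := expr_onem_le n.+1 dM.
  have Tn : 1 + T * d <= 1 + n.+1%:R * (d / M).
    by rewrite lerD2l mulrA ler_pdivlMr// mulrAC ler_pM2r// ltW.
  have Sq : S <= (1 + T * d) * (q / 2).
    have -> : (1 + T * d) * (q / 2) = q / 2 + S.
      by rewrite /T; field; rewrite !lt0r_neq0.
    by rewrite lerDr divr_ge0// ltW.
  have r0 : 0 <= (1 - d / M) ^+ n.+1 by rewrite exprn_ge0//; case/andP: dM01.
  apply: le_trans (ler_wpM2l r0 Sq) _.
  rewrite mulrA ger_pMl; last by rewrite divr_gt0.
  by apply: le_trans b; rewrite ler_wpM2l.
have := qform_powR_subr xsym xpsd x1 xd dM01 v0 small; rewrite -/q => main.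
have -> : qform (fun i j => (A i j + e * (i != j)%:R) `^ a) v =
    M `^ a * qform (fun i j => (1 - x i j) `^ a) v.
  rewrite /qform mulr_sumr; apply: eq_bigr => i _.
  rewrite mulr_sumr; apply: eq_bigr => j _.
  rewrite /x subKr !mulrA -powRM ?(ltW Mgt0)//; last first.
    by rewrite divr_ge0 ?(ltW Mgt0)// addr_ge0// mulr_ge0 ?(ltW e0).
  by congr (_ `^ a * _ * _); field; exact: lt0r_neq0.
apply: le_trans (ler_wpM2l (powR_ge0 _ _) main) _.
rewrite mulrN lerN2 !mulrA ler_pM2r ?invr_gt0// ler_pM2r//.
have tail : (1 - a) * ((T + 1) * M) `^ (- a) <= binom_tail a n.+1.
  apply: le_trans (binom_tail_lower a01 n); rewrite ler_wpM2l//; first by lra.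
  have nM : n.+1%:R <= (T + 1) * M.
    by rewrite mulrSr mulrDl mul1r lerD.
  rewrite 2!powRN lef_pV2 ?posrE ?powR_gt0//; last by rewrite mulr_gt0//; lra.
  by apply: ge0_ler_powR; rewrite ?nnegrE ?(ltW a0)// (le_trans _ nM).
apply: le_trans (ler_wpM2l (powR_ge0 M a) tail).
rewrite powRM; [|lra|exact: ltW].
rewrite mulrCA [X in _ * X](_ : _ = (T + 1) `^ (- a))//.
rewrite mulrCA -powRD; last by rewrite (lt0r_neq0 Mgt0) implybT.
by rewrite subrr powRr0 mulr1.
Qed.

(** The bound of [cnd_powR_perturbed] does not depend on the perturbation, hence
    survives its passage to [0]. *)
Lemma cnd_powR_lt0 A v : symmetric_kernel A -> (forall i, A i i = 0) ->
  (forall i j, i != j -> 0 < A i j) -> cnd A ->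
  \sum_i v i = 0 -> (exists i, v i != 0) ->
  qform (fun i j => A i j `^ a) v < 0.
Proof.
move=> Asym A0 Apos Acnd v0 [i0 vi0]; have /andP[a0 a1] := a01.
have q0 : 0 < \sum_i v i ^+ 2.
  rewrite (bigD1 i0)//= ltr_pwDl//; first by rewrite exprn_even_gt0//= vi0.
  by rewrite sumr_ge0// => i _; exact: sqr_ge0.
have [c c0 Hc] := cnd_powR_perturbed Asym A0 Apos Acnd v0 q0.
pose K := \sum_i \sum_j A i j `^ a / A i j * `|v i * v j|.
have K0 : 0 <= K.
  rewrite sumr_ge0// => i _; rewrite sumr_ge0// => j _.
  rewrite mulr_ge0// divr_ge0 ?powR_ge0//.
  by have [->|/Apos/ltW//] := eqVneq i j; rewrite A0.
have close e : 0 < e ->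
    qform (fun i j => A i j `^ a) v <=
    qform (fun i j => (A i j + e * (i != j)%:R) `^ a) v + e * K.
  move=> e0; rewrite /qform mulr_sumr -big_split; apply: ler_sum => i _.
  rewrite mulr_sumr -big_split/=; apply: ler_sum => j _.
  have [<-|ij] := eqVneq i j.
    rewrite mulr0 addr0 lerDl A0 powR0 ?gt_eqF// !mul0r mulr0//.
  rewrite mulr1 addrC -lerBlDr -2!mulrA -mulrBl.
  apply: le_trans (ler_norm _) _; rewrite normrM.
  rewrite [leRHS]mulrA ler_wpM2r// distrC.
  by apply: powR_addr_close; [exact: Apos|exact: ltW].
pose e := Num.min 1 (c / (2 * (K + 1))).
have K1 : 0 < 2 * (K + 1) by lra.
have e0 : 0 < e by rewrite lt_min ltr01 divr_gt0.
have e1 : e <= 1 by rewrite ge_min lexx.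
have eK : e * (2 * (K + 1)) <= c by rewrite -ler_pdivlMr// ge_min lexx orbT.
apply: le_lt_trans (close e e0) _.
have : 0 < e <= 1 by rewrite e0.
by move/Hc; have := mulr_ge0 (ltW e0) K0; lra.
Qed.

End PowersOfNegativeKernels.

(** * Linearly independent families and spanning sets *)

Section DimensionBound.

(** A nonzero maximal minor has a nonzero term in its Leibniz expansion. *)
Lemma row_free_transversal (F : fieldType) m n (M : 'M[F]_(m, n)) :
  row_free M -> exists2 f : 'I_m -> 'I_n, injective f & forall i, M i (f i) != 0.
Proof.
move=> Mfree; have Mfull : row_full M^T by rewrite /row_full mxrank_tr.
set f := fullrankfun Mfull; set N := rowsub f M^T.
have : \det N != 0.
  by rewrite -unitfE -unitmxE -row_full_unit fullrowsub_full.
have [/existsP[s sN] _|/existsPn N0] :=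
    boolP [exists s : {perm 'I_m}, \prod_i N i (s i) != 0]; last first.
  rewrite /determinant big1 ?eqxx// => s _.
  by have /negPn/eqP -> := N0 s; rewrite mulr0.
exists (fun i => f ((s^-1)%g i)).
  by move=> i j /fullrankfun_inj /perm_inj.
move=> i; apply: contra_neq sN => Mi.
by rewrite (bigD1 ((s^-1)%g i))//= /N !mxE permKV Mi mul0r.
Qed.

(** Rado's selection principle for injections: an ultrafilter on the finite
    subsets of [T] decides, at each [t], between the finitely many values taken
    by the partial injections. *)
Lemma injection_selection (T U : choiceType) (S : T -> seq U) :
  (forall A : {fset T}, exists g : T -> U,
     {in A &, injective g} /\ {in A, forall t, g t \in S t}) ->
  exists2 g : T -> U, injective g & forall t, g t \in S t.
Proof.
move=> /choice[g gP].
pose above (A : {fset T}) := [set B : {fset T} | (A `<=` B)%fset].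
have aboveF : Filter (filter_from setT above).
  apply: filter_fromT_filter; first by exists fset0.
  move=> A B; exists (A `|` B)%fset => C /=.
  by rewrite /above/= fsubUset => /andP.
have aboveP : ProperFilter (filter_from setT above).
  by apply: filter_from_proper => A _; exists A; rewrite /above/=.
have [G [Gultra aboveG]] := ultraFilterLemma aboveP.
have GP : ProperFilter G by exact: ultra_proper.
have GF : Filter G by exact: filter_filter.
have Gabove A : G (above A) by apply: aboveG; exists A.
pose takes t u := [set A : {fset T} | t \in A /\ g A t = u].
have /choice[h hP] : forall t, exists u, G (takes t u).
  move=> t; apply: contrapT => noval.
  have Gneq u : u \in [fset u in S t]%fset -> G (~` takes t u).
    have [] := in_ultra_setVsetC (takes t u) Gultra => //.
    by move=> Gu; exfalso; apply: noval; exists u.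
  have /(@filter_ex _ _ GP)[A [At]] :=
    @filterI _ _ GF _ _ (Gabove [fset t]%fset) (filter_bigI GF Gneq).
  move: At; rewrite /above/= fsub1set => tA.
  have [_ /(_ t tA) gS] := gP A.
  by move=> /(_ (g A t)); apply; rewrite /= ?inE.
exists h => [s t hst|t]; last first.
  have /(@filter_ex _ _ GP)[A [tA <-]] := hP t.
  by have [_] := gP A; apply.
have /(@filter_ex _ _ GP)[A [[sA gs] [tA gt]]] :=
  @filterI _ _ GF _ _ (hP s) (hP t).
by have [/(_ s t sA tA) + _] := gP A; rewrite gs gt; apply.
Qed.

Variables (F : fieldType) (E : lmodType F).

(** Each [v t] can be sent to the finitely many vectors of [B] that occur in a
    chosen expression of it. On a finite subfamily, independence says that the
    matrix of coefficients has independent rows, so that a transversal of its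
    nonzero entries provides the partial injection. *)
Lemma linear_independent_injection (T : choiceType) (v : T -> E) (B : set E) :
  (forall (I : finType) (x : I -> T) (c : I -> F), injective x ->
     \sum_i c i *: v (x i) = 0 -> forall i, c i = 0) ->
  (forall y : E, exists (n : nat) (w : 'I_n -> E) (c : 'I_n -> F),
     (forall i, B (w i)) /\ y = \sum_i c i *: w i) ->
  exists2 g : T -> E, injective g & forall t, B (g t).
Proof.
move=> vfree Bspan.
have /choice[S SP] : forall t, exists s : seq (F * E),
    (forall p, p \in s -> B p.2) /\ v t = \sum_(p <- s) p.1 *: p.2.
  move=> t; have [n [w [c [wB ->]]]] := Bspan (v t).
  exists [seq (c i, w i) | i <- enum 'I_n]; split; last first.
    by rewrite big_map big_enum/=.
  by move=> p /mapP[i _ ->]; exact: wB.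
have [|g ginj gS] := @injection_selection T E (fun t => [seq p.2 | p <- S t]).
  move=> A.
  pose s := undup [seq p.2 | p <- flatten [seq S t | t <- A]].
  (* An expression may use a vector several times: its coefficients are added. *)
  pose coef t b := \sum_(p <- S t | p.2 == b) p.1.
  pose r (i : 'I_#|{: A}|) : T := val (enum_val i).
  pose M := \matrix_(i < #|{: A}|, j < size s) coef (r i) s`_j.
  have vE i : v (r i) = \sum_j M i j *: s`_j.
    have [_ ->] := SP (r i).
    under [RHS]eq_bigr do rewrite mxE /coef scaler_suml.
    rewrite (exchange_big_dep xpredT)//=.
    rewrite big_seq [RHS]big_seq; apply: eq_bigr => p pS.
    have ps : p.2 \in s.
      rewrite mem_undup map_f//; apply/flattenP; exists (S (r i)) => //.
      by apply: map_f; exact: fsvalP.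
    have ips : (index p.2 s < size s)%N by rewrite index_mem.
    rewrite (bigD1 (Ordinal ips))/= ?nth_index//.
    rewrite big1 ?addr0// => j /andP[/eqP pj /eqP]; case.
    by apply: val_inj; rewrite /= pj index_uniq ?undup_uniq.
  have : row_free M.
    rewrite -kermx_eq0; apply/rowV0P => u /sub_kermxP uM.
    apply/rowP => i; rewrite mxE.
    have rinj : injective r by move=> i1 i2 /val_inj/enum_val_inj.
    apply: (vfree _ r (u 0)) => //.
    under eq_bigr do rewrite vE scaler_sumr.
    rewrite exchange_big/= big1// => j _.
    under eq_bigr do rewrite scalerA.
    rewrite -scaler_suml (_ : \sum_i _ = (u *m M) 0 j); last by rewrite mxE.
    by rewrite uM mxE scale0r.
  move=> /row_free_transversal[f finj fM].
  pose g t : E := if insub t is Some a then s`_(f (enum_rank (a : A))) else 0.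
  have gE t (tA : t \in A) : g t = s`_(f (enum_rank [` tA]%fset)).
    by rewrite /g insubT.
  exists g; split => [t1 t2 t1A t2A|t tA].
    rewrite !gE => /eqP; rewrite nth_uniq ?undup_uniq//.
    by move/eqP/val_inj/finj/enum_rank_inj/(congr1 val).
  have := fM (enum_rank [` tA]%fset); rewrite mxE gE /r enum_rankK /=.
  set b := s`_ _ => cb; apply: contraNT cb => bS.
  rewrite /coef big_seq_cond big1// => p /andP[pS /eqP pb].
  by move: bS; rewrite -pb map_f.
exists g => // t; have /mapP[p pS ->] := gS t.
by have [+ _] := SP t; apply.
Qed.

End DimensionBound.

(** * Finitely supported functions *)

Section FinitelySupportedFunctions.
Variables (T : choiceType) (R : realType).

Definition finite_support_pred : {pred T -> R} :=
  fun f => `[< finite_set [set x | f x != 0] >].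

Lemma finite_support_submod : submod_closed finite_support_pred.
Proof.
split=> [|k f g].
  apply/asboolP; rewrite [X in finite_set X](_ : _ = set0)//.
  by apply/seteqP; split => x //=; rewrite eqxx.
move=> /asboolP fA /asboolP fB; apply/asboolP.
have fAB : finite_set ([set x | f x != 0] `|` [set x | g x != 0]).
  by rewrite finite_setU.
apply: sub_finite_set fAB => x /=.
apply: contraNP => /not_orP[/negP/negPn/eqP fx /negP/negPn/eqP gx].
by rewrite !fctE fx gx scaler0 addr0.
Qed.

HB.instance Definition _ :=
  GRing.isSubmodClosed.Build R (T -> R) finite_support_pred finite_support_submod.

Record finsupp := FinSupp {
  finsupp_fun :> T -> R;
  _ : finsupp_fun \in finite_support_pred }.

HB.instance Definition _ := [isSub for finsupp_fun].
HB.instance Definition _ := [Choice of finsupp by <:].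
HB.instance Definition _ := [SubChoice_isSubLmodule of finsupp by <:].

Implicit Types (f g : finsupp).

Lemma finsuppP f g : f =1 g -> f = g.
Proof. by move=> fg; apply: val_inj; exact/funext. Qed.

Lemma finsuppZ k f x : (k *: f) x = k * f x. Proof. by []. Qed.

Lemma finsupp_sum (I : finType) (F : I -> finsupp) x :
  (\sum_i F i) x = \sum_i F i x.
Proof. by elim/big_rec2 : _ => // i y z _ <-. Qed.

Definition supp f : {fset T} := fset_set [set x | f x != 0].

Lemma mem_supp f x : (x \in supp f) = (f x != 0).
Proof.
rewrite in_fset_set; first by apply/idP/idP; rewrite inE.
by have /asboolP := valP f.
Qed.

Lemma delta_subproof (x : T) : (fun y => (y == x)%:R) \in finite_support_pred.
Proof.
apply/asboolP; apply: sub_finite_set (finite_set1 x) => y /=.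
by have [->|] := eqVneq y x; rewrite ?eqxx.
Qed.

Definition delta (x : T) : finsupp := FinSupp (delta_subproof x).

Lemma finsupp_decomp f : f = \sum_(x : supp f) f (val x) *: delta (val x).
Proof.
apply: finsuppP => y; rewrite finsupp_sum.
under eq_bigr do rewrite finsuppZ /=.
have [ys|ys] := boolP (y \in supp f).
  rewrite (bigD1 [` ys]%fset)//= eqxx mulr1 big1 ?addr0// => x.
  by rewrite -val_eqE/= eq_sym => /negPf ->; rewrite mulr0.
rewrite big1 => [|x _]; first by move: ys; rewrite mem_supp => /negPn/eqP.
have [yx|] := eqVneq y (val x); last by rewrite mulr0.
by move: ys; rewrite yx fsvalP.
Qed.

(** The linear extension of [k], point masses being identified with points. *)
Definition lin_ext (k : T -> R) f : R := \sum_(x : supp f) f (val x) * k (val x).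

Lemma lin_ext_fset (A : {fset T}) k f : (supp f `<=` A)%fset ->
  lin_ext k f = \sum_(x : A) f (val x) * k (val x).
Proof.
move=> /fsubsetP sA.
rewrite /lin_ext -!(big_seq_fsetE _ _ xpredT (fun x => f x * k x))/=.
rewrite [RHS](bigID (mem (supp f)))/= [X in _ + X]big1 ?addr0; last first.
  by move=> x; rewrite mem_supp negbK => /eqP ->; rewrite mul0r.
rewrite -[RHS]big_filter; apply: perm_big; apply: uniq_perm.
- exact: fset_uniq.
- exact/filter_uniq/fset_uniq.
- by move=> x; rewrite mem_filter; apply/idP/andP => [xf|[]//]; rewrite xf sA.
Qed.

Lemma lin_ext_linear k : linear_for *%R (lin_ext k).
Proof.
move=> c f g; set h : finsupp := c *: f + g.
pose A := (supp f `|` supp g `|` supp h)%fset.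
rewrite !(@lin_ext_fset A) ?fsubsetUr//; last first.
- by rewrite /A -fsetUA fsubsetUl.
- by rewrite /A (fsetUC (supp f)) -fsetUA fsubsetUl.
rewrite mulr_sumr -big_split/=; apply: eq_bigr => x _.
transitivity ((c * f (val x) + g (val x)) * k (val x)) => //.
by ring.
Qed.

Lemma lin_ext_delta k x : lin_ext k (delta x) = k x.
Proof.
have sx : supp (delta x) = [fset x]%fset.
  apply/fsetP => y; rewrite mem_supp in_fset1 /=.
  by have [|] := eqVneq y x; rewrite ?oner_eq0 ?eqxx.
rewrite /lin_ext sx -(big_seq_fsetE _ _ xpredT (fun y => delta x y * k y))/=.
by rewrite big_seq_fset1 eqxx mul1r.
Qed.

End FinitelySupportedFunctions.

(** * The norm of an inner product *)

Section DotNorm.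
Variables (R : realType) (U : lmodType R) (form : {dot U for idfun}).

Lemma dotC (u v : U) : form u v = form v u.
Proof. by rewrite hermC expr0 mul1r. Qed.

Lemma dotZl c (u v : U) : form (c *: u) v = c * form u v.
Proof. by rewrite linearZl_LR. Qed.

Lemma dotZr c (u v : U) : form u (c *: v) = c * form u v.
Proof. by rewrite linearZr_LR. Qed.

Lemma dot_ge0 (u : U) : 0 <= form u u.
Proof.
have [->|/neq0_dnorm_gt0/ltW//] := eqVneq u 0.
by rewrite linear0l.
Qed.

Definition dot_norm (u : U) : R := Num.sqrt (form u u).

Lemma sqr_dot_norm u : dot_norm u ^+ 2 = form u u.
Proof. by rewrite sqr_sqrtr// dot_ge0. Qed.

Lemma dotDD u v : form (u + v) (u + v) = form u u + 2 * form u v + form v v.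
Proof. by rewrite linearDl !linearDr/= (dotC v u); ring. Qed.

Lemma dotBB u v : form (u - v) (u - v) = form u u - 2 * form u v + form v v.
Proof. by rewrite linearBl !linearBr/= (dotC v u); ring. Qed.

Lemma cauchy_schwarz u v : `|form u v| <= dot_norm u * dot_norm v.
Proof.
rewrite -(@ler_pXn2r _ 2)// ?nnegrE ?mulr_ge0 ?sqrtr_ge0//.
rewrite exprMn !sqr_dot_norm real_normK ?num_real//.
have [->|v0] := eqVneq v 0.
  by rewrite linear0r expr0n mulr_ge0// dot_ge0.
have vv : 0 < form v v by exact: neq0_dnorm_gt0.
have := dot_ge0 (u - (form u v / form v v) *: v).
rewrite dotBB !dotZr dotZl => H.
have {}H : 0 <= form u u - form u v ^+ 2 / form v v.
  rewrite (le_trans H)// le_eqVlt; apply/orP; left; apply/eqP.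
  by field; exact: lt0r_neq0.
by move: H; rewrite subr_ge0 ler_pdivrMr.
Qed.

Lemma dot_norm_triangle u v : dot_norm (u + v) <= dot_norm u + dot_norm v.
Proof.
rewrite -(@ler_pXn2r _ 2)// ?nnegrE ?addr_ge0 ?sqrtr_ge0//.
rewrite sqrrD !sqr_dot_norm dotDD lerD2r lerD2l mulr_natl.
by rewrite lerMn2r (le_trans (ler_norm _) (cauchy_schwarz _ _)).
Qed.

Lemma dot_normZ c u : dot_norm (c *: u) = `|c| * dot_norm u.
Proof.
by rewrite /dot_norm dotZl dotZr mulrA -expr2 sqrtrM ?sqr_ge0// sqrtr_sqr.
Qed.

Lemma dot_norm_eq0 u : dot_norm u = 0 -> u = 0.
Proof.
move/(congr1 (fun x => x ^+ 2)); rewrite sqr_dot_norm expr0n/= => uu.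
by apply: contraPeq uu => /neq0_dnorm_gt0 => /(_ _ form)/lt0r_neq0/eqP.
Qed.

(** As the coefficients have sum zero, only the cross terms survive the expansion
    of the squares: this is what ties 2-negative type to inner products. *)
Lemma qform_sqr_dist (I : finType) (y : I -> U) (c : I -> R) :
  \sum_i c i = 0 ->
  qform (fun i j => dot_norm (y i - y j) ^+ 2) c =
  - (2 * dot_norm (\sum_i c i *: y i) ^+ 2).
Proof.
move=> c0; rewrite sqr_dot_norm linear_sumlz.
under [in RHS]eq_bigr do rewrite linear_sumr.
have null (F : I -> R) : \sum_i \sum_j c i * (F i * c j) = 0.
  by rewrite big1// => i _; rewrite -!mulr_sumr c0 !mulr0.
transitivity (\sum_i \sum_j c i * (form (y i) (y i) * c j) +
  \sum_j \sum_i c j * (form (y j) (y j) * c i) -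
  2 * \sum_i \sum_j form (c i *: y i) (c j *: y j)); last first.
  by rewrite !null; ring.
rewrite [X in _ + X - _]exchange_big/= mulr_sumr -big_split -sumrB/=.
apply: eq_bigr => i _; rewrite mulr_sumr -big_split -sumrB/=.
apply: eq_bigr => j _.
by rewrite sqr_dot_norm dotBB dotZl dotZr; ring.
Qed.

End DotNorm.

(** * The Euclidean space of a strictly positive kernel *)

Section GramSpace.
Variables (R : realType).

Definition spd_kernel (T : Type) (K : T -> T -> R) :=
  (forall x y, K x y = K y x) /\
  forall (I : finType) (x : I -> T) (c : I -> R), injective x ->
    (exists i, c i != 0) -> 0 < qform (fun i j => K (x i) (x j)) c.

(** The type records the proof that [K] is strictly positive, so that the inner
    product defined by [K] can be attached to it. *)
Definition gram_space (T : choiceType) (K : T -> T -> R) of spd_kernel K : Type :=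
  finsupp T R.

Section GramSpaceTheory.
Variables (T : choiceType) (K : T -> T -> R) (HK : spd_kernel K).
Local Notation V := (gram_space HK).

HB.instance Definition _ := GRing.Lmodule.on V.

(** The bilinear form with Gram matrix [K] on the point masses. *)
Definition gram (f g : V) : R := lin_ext (fun x => lin_ext (K x) g) f.

Lemma gram_fset (A : {fset T}) (f g : V) :
  (supp f `<=` A)%fset -> (supp g `<=` A)%fset ->
  gram f g = \sum_(x : A) \sum_(y : A) K (val x) (val y) * f (val x) * g (val y).
Proof.
move=> fA gA; rewrite /gram (lin_ext_fset _ fA); apply: eq_bigr => x _.
rewrite (lin_ext_fset _ gA) mulr_sumr; apply: eq_bigr => y _; ring.
Qed.

Lemma gram_sym (f g : V) : gram f g = gram g f.
Proof.
pose A := (supp f `|` supp g)%fset.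
rewrite !(@gram_fset A) ?fsubsetUl ?fsubsetUr// exchange_big/=.
apply: eq_bigr => x _; apply: eq_bigr => y _.
by have [Ksym _] := HK; rewrite (Ksym (val y)); ring.
Qed.

Lemma gram_linearl (g : V) : linear_for *%R (gram^~ g).
Proof. move=> c f1 f2; exact: lin_ext_linear. Qed.

Lemma gram_linearr (f : V) : linear_for *%R (gram f).
Proof. by move=> c g1 g2; rewrite !(gram_sym f) gram_linearl. Qed.

HB.instance Definition _ := bilinear_isBilinear.Build R V V R *%R
  (idfun \; *%R) gram (gram_linearl, gram_linearr).

Lemma gram_hermitian (f g : V) : gram f g = (-1) ^+ false * idfun (gram g f).
Proof. by rewrite expr0 mul1r gram_sym. Qed.

HB.instance Definition _ :=
  @isHermitianSesquilinear.Build R V false idfun gram gram_hermitian.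

Lemma gram_gt0 (f : V) : f != 0 -> 0 < gram f f.
Proof.
move=> f0; rewrite (gram_fset (fsubset_refl (supp f)) (fsubset_refl (supp f))).
have [_ Kpos] := HK.
apply: (Kpos _ (fun x : supp f => val x) (fun x => f (val x))) => [x y /val_inj//|].
apply: contrapT => nof; case/eqP : f0; apply: finsuppP => x.
apply: contrapT => /eqP fx; apply: nof.
have xf : x \in supp f by rewrite mem_supp.
by exists [` xf]%fset.
Qed.

HB.instance Definition _ := @isDotProduct.Build R V gram gram_gt0.

HB.instance Definition _ := Lmodule_isNormed.Build R V
  (@dot_norm_triangle R V gram) (@dot_normZ R V gram) (@dot_norm_eq0 R V gram).

Definition gram_euclidean : euclideanType R :=
  @Euclidean R V gram (fun _ => erefl).

Lemma gram_delta x y : gram (delta R x) (delta R y) = K x y.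
Proof. by rewrite /gram !lin_ext_delta. Qed.

Lemma gram_space_dimension : algebraic_dimension (gram_euclidean : lmodType R) T.
Proof.
have delta_inj : injective (@delta T R).
  move=> x y /(congr1 (fun f : finsupp T R => f x))/=; rewrite eqxx => /esym/eqP.
  by have [//|_] := eqVneq x y; rewrite eq_sym oner_eq0.
exists (range (@delta T R : T -> V)); last first.
  by apply: inj_card_eq => x y _ _ /delta_inj.
split=> [n v c vinj vdelta cv k|f].
  have /choice[x xv] : forall i, exists x, delta R x = v i.
    by move=> i; have [x _ <-] := vdelta i; exists x.
  have /(congr1 (fun f : finsupp T R => f (x k))) := cv.
  rewrite [LHS](@finsupp_sum T R _ (fun i => c i *: v i)).
  under eq_bigr do rewrite -xv.
  rewrite (eq_bigr (fun i => c i * (x k == x i)%:R))//.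
  rewrite (bigD1 k)//= big1 => [|i ik]; first by rewrite eqxx mulr1 addr0.
  have [xki|] := eqVneq (x k) (x i); last by rewrite mulr0.
  by move: ik; rewrite -(inj_eq vinj) -!xv xki eqxx.
exists #|{: supp f}|, (fun i => delta R (val (enum_val i))),
  (fun i => f (val (enum_val i))); split; first by move=> i; exists (val (enum_val i)).
by rewrite [LHS](finsupp_decomp f) big_enum_val.
Qed.

End GramSpaceTheory.
End GramSpace.

(** * Spaces of p-negative type with p > 2 *)

Section NegativeType.
Variables (R : realType) (p : R).
Hypothesis p2 : 2 < p.

(** The square of [D] is the power [2 / p < 1] of [D ^ p]. *)
Lemma qform_sqr_lt0 (I : finType) (D : I -> I -> R) (v : I -> R) :
  symmetric_kernel D -> (forall i, D i i = 0) ->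
  (forall i j, i != j -> 0 < D i j) -> cnd (fun i j => D i j `^ p) ->
  \sum_i v i = 0 -> (exists i, v i != 0) ->
  qform (fun i j => D i j ^+ 2) v < 0.
Proof.
move=> Dsym D0 Dpos Dcnd v0 vn0.
have pgt0 : 0 < p by exact: lt_trans p2.
have p01 : 0 < 2 / p < 1 by rewrite divr_gt0//= ltr_pdivrMr// mul1r.
have D_ge0 i j : 0 <= D i j.
  by have [->|/Dpos/ltW//] := eqVneq i j; rewrite D0.
have := @cnd_powR_lt0 _ _ _ p01 (fun i j => D i j `^ p) v.
rewrite (_ : qform _ v = qform (fun i j => D i j ^+ 2) v); last first.
  apply: eq_bigr => i _; apply: eq_bigr => j _; congr (_ * _ * _).
  by rewrite -powRrM mulrCA mulfV ?gt_eqF// mulr1 powR_mulrn.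
apply => //.
- by move=> i j; rewrite Dsym.
- by move=> i; rewrite D0 powR0// gt_eqF.
- by move=> i j /Dpos ?; rewrite powR_gt0.
Qed.

(** Two descriptions of one quadratic form: strict negativity, and vanishing at
    the coefficients of an affine dependence. *)
Lemma affinely_independent (E : euclideanType R) (I : finType) (y : I -> E)
    (c : I -> R) :
  injective y -> cnd (fun i j => `|y i - y j| `^ p) ->
  \sum_i c i = 0 -> \sum_i c i *: y i = 0 -> forall i, c i = 0.
Proof.
move=> yinj ycnd c0 cy i; apply: contrapT => /eqP ci.
have : qform (fun i j => `|y i - y j| ^+ 2) c < 0.
  apply: qform_sqr_lt0 => //; last by exists i.
  - by move=> j k; rewrite distrC.
  - by move=> j; rewrite subrr normr0.
  - by move=> j k jk; rewrite normr_gt0 subr_eq0 (inj_eq yinj).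
have -> : qform (fun i j => `|y i - y j| ^+ 2) c =
          qform (fun i j => dot_norm (inner E) (y i - y j) ^+ 2) c.
  by apply: eq_bigr => j _; apply: eq_bigr => k _; rewrite euclidean_normE.
by rewrite qform_sqr_dist// cy sqr_dot_norm linear0l mulr0 oppr0 ltxx.
Qed.

Variable (X : metricType R).
Hypothesis Xneg : negative_type p X.

Lemma negative_type_cnd (I : finType) (x : I -> X) : injective x ->
  cnd (fun i j => mdist (x i) (x j) `^ p).
Proof.
move=> xinj c c0.
have sum_enum (F : I -> R) : \sum_(k < #|I|) F (enum_val k) = \sum_i F i.
  by rewrite [RHS](reindex _ (onW_bij _ (enum_val_bij I))).
have einj : injective (fun k : 'I_#|I| => x (enum_val k)).
  by move=> k l /xinj/enum_val_inj.
have := Xneg einj (eq_trans (sum_enum c) c0); congr (_ <= _).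
rewrite /qform -sum_enum; apply: eq_bigr => k _.
by rewrite -[RHS]sum_enum.
Qed.

Lemma negative_type_sqr_lt0 (I : finType) (x : I -> X) (c : I -> R) :
  injective x -> \sum_i c i = 0 -> (exists i, c i != 0) ->
  qform (fun i j => mdist (x i) (x j) ^+ 2) c < 0.
Proof.
move=> xinj; apply: qform_sqr_lt0; last exact: negative_type_cnd.
- by move=> i j; rewrite metric_sym.
- by move=> i; rewrite mdistxx.
- by move=> i j ij; rewrite mdist_gt0 (inj_eq xinj).
Qed.

Variable x0 : X.

(** Inner product of [x - x0] and [y - x0] by the law of cosines, plus [1]. The
    added constant makes [x0] a unit vector instead of the origin and adds to a
    form of coefficients [c] the square of their sum. *)
Definition dist_kernel (x y : X) : R :=
  1 + (mdist x x0 ^+ 2 + mdist y x0 ^+ 2 - mdist x y ^+ 2) / 2.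

Lemma dist_kernel_base x : dist_kernel x x0 = 1.
Proof. by rewrite /dist_kernel mdistxx; field. Qed.

Lemma dist_kernel_dist x y :
  dist_kernel x x - 2 * dist_kernel x y + dist_kernel y y = mdist x y ^+ 2.
Proof. by rewrite /dist_kernel !mdistxx; field. Qed.

Lemma qform_dist_kernel (I : finType) (x : I -> X) (c : I -> R) :
  qform (fun i j => dist_kernel (x i) (x j)) c =
  (\sum_i c i) ^+ 2 + (\sum_i c i) * (\sum_i mdist (x i) x0 ^+ 2 * c i) -
  qform (fun i j => mdist (x i) (x j) ^+ 2) c / 2.
Proof.
set s := \sum_i c i; set m := \sum_i mdist (x i) x0 ^+ 2 * c i.
have e1 : s * m = \sum_i \sum_j c j * (mdist (x i) x0 ^+ 2 * c i).
  by rewrite mulr_suml exchange_big/=; apply: eq_bigr => i _; rewrite mulr_sumr.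
have e2 : s * m = \sum_i \sum_j c i * (mdist (x j) x0 ^+ 2 * c j).
  by rewrite mulr_suml; apply: eq_bigr => i _; rewrite mulr_sumr.
have -> : s ^+ 2 + s * m = qform (fun _ _ => 1) c + (s * m) / 2 + (s * m) / 2.
  by rewrite qform_const -/s; field.
rewrite {1}e1 e2 /qform !mulr_suml -!big_split -sumrB/=; apply: eq_bigr => i _.
rewrite !mulr_suml -!big_split -sumrB/=; apply: eq_bigr => j _.
by rewrite /dist_kernel; field.
Qed.

(** A family avoiding [x0] is completed by [x0] with coefficient [0]; moving
    the total mass onto [x0] then gives a form of coefficients of sum zero. *)
Lemma dist_kernel_spd : spd_kernel dist_kernel.
Proof.
split=> [x y|I x c xinj cn0].
  by rewrite /dist_kernel (metric_sym x y); ring.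
rewrite qform_dist_kernel; set s := \sum_i c i.
have [s0|s0] := eqVneq s 0.
  rewrite s0 expr0n/= mul0r !add0r oppr_gt0.
  by rewrite pmulr_llt0 ?invr_gt0//; exact: negative_type_sqr_lt0.
suff H : qform (fun i j => mdist (x i) (x j) ^+ 2) c <=
    2 * s * (\sum_i mdist (x i) x0 ^+ 2 * c i).
  have : 0 < s ^+ 2 by rewrite exprn_even_gt0.
  by move: H; lra.
have shift (J : finType) (y : J -> X) (d : J -> R) (j0 : J) : injective y ->
    y j0 = x0 -> qform (fun i j => mdist (y i) (y j) ^+ 2) d <=
    2 * (\sum_j d j) * (\sum_j mdist (y j) x0 ^+ 2 * d j).
  move=> yinj yj0; set t := \sum_j d j.
  pose d' j := d j + (- t) * (j == j0)%:R.
  have d'0 : \sum_j d' j = 0.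
    by rewrite big_split/= (sum_delta (fun=> - t)) subrr.
  have : qform (fun i j => mdist (y i) (y j) ^+ 2) d' <= 0.
    have [dn0|] := pselect (exists j, d' j != 0).
      by apply/ltW/negative_type_sqr_lt0.
    move=> /forallNP dz; rewrite /qform big1// => i _; rewrite big1// => j _.
    by have /negP/negPn/eqP -> := dz j; rewrite mulr0.
  rewrite qform_shift; last by move=> i j; rewrite metric_sym.
  rewrite yj0 mdistxx expr0n/= mulr0 addr0.
  by under [X in _ + _ * X]eq_bigr do rewrite metric_sym; lra.
have [[i0 xi0]|nox0] := pselect (exists i, x i = x0); first exact: shift xi0.
pose y (o : option I) := oapp x x0 o; pose d (o : option I) := oapp c 0 o.
have yinj : injective y.
  move=> [i|] [j|]//= => [/xinj -> //|xi|xi]; exfalso; apply: nox0.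
    by exists i.
  by exists j.
have drop0 (F : option I -> R) : F None = 0 -> \sum_o F o = \sum_i F (Some i).
  by move=> F0; rewrite sum_option F0 add0r.
have := shift _ y d None yinj erefl.
rewrite /qform !drop0/= ?mulr0//; last by rewrite big1// => o _; rewrite mulr0 mul0r.
by under eq_bigr do rewrite drop0/= ?mulr0//.
Qed.

End NegativeType.

(** * Closedness of isometric copies that span *)

Section ClosedRange.
Variables (R : realType) (p : R) (X : metricType R) (E : euclideanType R).
Hypotheses (p2 : 2 < p) (Xneg : negative_type p X).

Lemma powR_continuous_at (a : R) : 0 < a -> {for a, continuous (@powR R ^~ p)}.
Proof.
move=> a0; have : derivable (@powR R ^~ p) a 1.
  by apply: derivable_powR; rewrite in_itv/= a0.
by move=> /derivable1_diffP/differentiable_continuous.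
Qed.

Lemma isometric_injective (f : X -> E) : isometric_embedding f -> injective f.
Proof.
move=> fiso x y fxy; apply: mdist_positivity.
by rewrite -fiso fxy subrr normr0.
Qed.

(** A limit of points [f x] extends [range f] by one point and inherits the
    negative type inequality, as the limit of inequalities in which that point
    is replaced by [f x]. *)
Lemma limit_cnd (f : X -> E) (y : E) (I : finType) (x : I -> X) :
  isometric_embedding f -> closure (range f) y -> ~ range f y -> injective x ->
  let z (o : option I) := oapp (fun i => f (x i)) y o in
  cnd (fun i j => `|z i - z j| `^ p).
Proof.
move=> fiso fy yNf xinj z v v0.
pose P (w : E) (o : option I) := oapp (fun i => f (x i)) w o.
pose Q w := qform (fun i j => `|P w i - P w j| `^ p) v.
have yx i : y != f (x i) by apply/eqP => yfx; apply: yNf; exists (x i).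
have entry_cvg o o' : `|P w o - P w o'| `^ p @[w --> y] --> `|z o - z o'| `^ p.
  have half i : `|w - f (x i)| `^ p @[w --> y] --> `|y - f (x i)| `^ p.
    apply: (@continuous_cvg _ _ _ _ _ (fun w => `|w - f (x i)|) (@powR R ^~ p)).
      by apply: powR_continuous_at; rewrite normr_gt0 subr_eq0.
    by apply: cvg_norm; apply: cvgB; [exact: cvg_id|exact: cvg_cst].
  case: o o' => [i|] [j|] /=.
  - exact: cvg_cst.
  - rewrite distrC; under eq_cvg do rewrite distrC; exact: half.
  - exact: half.
  - rewrite subrr; under eq_cvg do rewrite subrr; exact: cvg_cst.
have Qcvg : Q w @[w --> y] --> qform (fun i j => `|z i - z j| `^ p) v.
  apply: cvg_big => [|i _]; first exact: add_continuous.
  apply: cvg_big => [|j _]; first exact: add_continuous.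
  by apply: cvgMl; apply: cvgMl.
rewrite leNgt; apply/negP => Qpos.
have Qnear : \forall w \near y, 0 < Q w by exact: cvgr_gt Qcvg _ Qpos.
have xnear : \forall w \near y, forall i, w != f (x i).
  apply: filter_forall => i.
  have : (w - f (x i)) @[w --> y] --> y - f (x i).
    by apply: cvgB; [exact: cvg_id|exact: cvg_cst].
  move/cvgr_neq0; rewrite subr_eq0 => /(_ (yx i)).
  by apply: filterS => w; rewrite subr_eq0.
have [_ [[t _ <-] [Qt tx]]] := fy _ (filterI Qnear xnear).
pose u (o : option I) := oapp x t o.
have uinj : injective u.
  move=> [i|] [j|]//= => [/xinj -> //|xi|xi].
    by have := tx i; rewrite xi eqxx.
  by have := tx j; rewrite -xi eqxx.
have := negative_type_cnd Xneg uinj v0; rewrite leNgt => /negP; apply.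
suff -> : qform (fun i j => mdist (u i) (u j) `^ p) v = Q (f t) by [].
apply: eq_bigr => o _; apply: eq_bigr => o' _.
by rewrite -fiso /u /P; case: o o' => [i|] [j|].
Qed.

(** Any [y] is a combination of finitely many points [f x]. The vector [e] makes
    the sum of the coefficients a continuous function of [y], so that for [y] in
    the closure of [range f] the combination is affine; outside [range f] this
    would be an affine dependence, which [limit_cnd] excludes. *)
Lemma closed_isometric_range (f : X -> E) (e : E) :
  isometric_embedding f -> (forall x, inner E (f x) e = 1) ->
  (forall y, exists (I : finType) (x : I -> X) (c : I -> R),
     injective x /\ y = \sum_i c i *: f (x i)) ->
  closed (range f).
Proof.
move=> fiso fe fspan y fy; apply: contrapT => yNf.
have ye : inner E y e = 1.
  apply/eqP; rewrite -subr_eq0 -normr_le0; apply/ler_addgt0Pl => d d0.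
  rewrite addr0.
  have e1 : 0 < `|e| + 1 by rewrite ltr_wpDl.
  have [_ [[x _ <-] xy]] := fy _ (nbhsx_ballx y _ (divr_gt0 d0 e1)).
  rewrite -(fe x) -linearBl (le_trans (cauchy_schwarz _ _ _))//.
  rewrite /dot_norm -!euclidean_normE.
  move: xy; rewrite -ball_normE/= ltr_pdivlMr// => /ltW; apply: le_trans.
  by rewrite ler_wpM2l// lerDl.
have [I [x [c [xinj yE]]]] := fspan y.
have csum : \sum_i c i = 1.
  rewrite -ye yE linear_sumlz; apply: eq_bigr => i _.
  by rewrite [RHS](dotZl (inner E)) fe mulr1.
pose z (o : option I) := oapp (fun i => f (x i)) y o.
pose d (o : option I) := oapp c (-1) o.
have zinj : injective z.
  move=> [i|] [j|]//= => [/(isometric_injective fiso)/xinj -> //|xi|xi].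
    by exfalso; apply: yNf; exists (x i).
  by exfalso; apply: yNf; exists (x j).
have d0 : \sum_o d o = 0 by rewrite sum_option/= csum addNr.
have dz : \sum_o d o *: z o = 0 by rewrite sum_option/= -yE scaleN1r addNr.
have := affinely_independent p2 zinj (limit_cnd fiso fy yNf xinj) d0 dz None.
by move/eqP; rewrite oppr_eq0 oner_eq0.
Qed.

End ClosedRange.

(** * Embeddings of hard spaces *)

(** Reindexing by [s] makes room for a base point at no cost in cardinality. *)
Lemma infinite_avoiding_injection (X : Type) : infinite_set [set: X] ->
  exists x0 : X, exists2 s : X -> X, injective s & forall x, s x <> x0.
Proof.
move=> /infiniteP/card_leP[e0].
pose e n : X := set_val (e0 (to_setT n)).
have einj : injective e.
  move=> m n /val_inj emn; have : to_setT m = to_setT n by apply: inj emn; rewrite inE.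
  by move/(congr1 val).
have /choice[s sP] : forall x : X, exists y : X,
    (forall n, x = e n -> y = e n.+1) /\ ((forall n, x <> e n) -> y = x).
  move=> x; have [[n ->]|xe] := pselect (exists n, x = e n).
    by exists (e n.+1); split=> [m /einj <-//|/(_ n)].
  by exists x; split=> [n xn|//]; exfalso; apply: xe; exists n.
exists (e 0%N), s => [x y|x].
  have [sx sx'] := sP x; have [sy sy'] := sP y.
  have [[m xm]|/forallNP xe] := pselect (exists n, x = e n);
      have [[n yn]|/forallNP ye] := pselect (exists n, y = e n).
  - by rewrite (sx _ xm) (sy _ yn) xm yn => /einj[->].
  - by rewrite (sx _ xm) (sy' ye) => /esym/ye.
  - by rewrite (sy _ yn) (sx' xe) => /xe.
  - by rewrite (sx' xe) (sy' ye).
have [sx sx'] := sP x.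
have [[n xn]|/forallNP xe] := pselect (exists n, x = e n).
  by rewrite (sx _ xn) => /einj.
by rewrite (sx' xe); exact: xe.
Qed.

Section HardSpaces.
Variables (R : realType) (psi : Type) (X : metricType R).
Hypothesis Xhard : hard psi X.

(** The base point [x0] serves as the vector [e] of [closed_isometric_range],
    since the kernel takes the value [1] at every pair [x, x0]. *)
Lemma hard_closed_embedding : exists E : euclideanType R,
  algebraic_dimension E psi /\
  exists f : X -> E, isometric_embedding f /\ closed (range f).
Proof.
have [psi_inf Xpsi [p p2 Xneg]] := Xhard.
have [x0 _] : [set: X] !=set0.
  by apply/infinite_setN0; rewrite (eq_finite_set Xpsi).
pose spd := dist_kernel_spd p2 Xneg x0.
exists (gram_euclidean spd); split.
  have [B Bbasis BX] := gram_space_dimension spd.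
  by exists B => //; apply: card_eq_trans BX Xpsi.
have fiso : @isometric_embedding R X (gram_euclidean spd) (@delta X R).
  move=> x y; rewrite euclidean_normE -[RHS]ger0_norm ?mdist_ge0// -sqrtr_sqr.
  congr (Num.sqrt _); rewrite dotBB -(dist_kernel_dist x0).
  by congr (_ - 2 * _ + _); exact: gram_delta.
exists (@delta X R); split=> //.
have := @closed_isometric_range R p X (gram_euclidean spd) p2 Xneg _ (delta R x0) fiso.
apply=> [x|y].
  by rewrite -(dist_kernel_base x0 x); exact: gram_delta.
exists {: supp y}, (fun x => val x), (fun x => y (val x)).
by split; [exact: val_inj|exact: finsupp_decomp].
Qed.

(** The differences [f (s x) - f x0], where [s] avoids [x0], are linearly
    independent because the points [f x] are affinely independent, so they inject
    into the basis. *)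
Lemma hard_no_embedding (sigma : Type) (F : euclideanType R) :
  card_lt sigma psi -> algebraic_dimension F sigma ->
  ~ exists f : X -> F, isometric_embedding f.
Proof.
move=> [sigma_le sigma_neq] [B [_ Bspan] Bsigma] [f fiso].
have [psi_inf Xpsi [p p2 Xneg]] := Xhard.
have Xinf : infinite_set [set: X] by rewrite (eq_finite_set Xpsi).
have [x0 [s sinj sx0]] := infinite_avoiding_injection Xinf.
have [||g ginj gB] :=
    @linear_independent_injection _ F X (fun x => f (s x) - f x0) B.
- move=> I x c xinj cx i.
  pose u (o : option I) := oapp (fun i => s (x i)) x0 o.
  pose d (o : option I) := oapp c (- \sum_i c i) o.
  have uinj : injective u.
    move=> [j|] [k|]//= => [/sinj/xinj -> //|xj|/esym xk].
      by have := sx0 _ xj.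
    by have := sx0 _ xk.
  have fuinj : injective (fun o => f (u o)).
    by move=> o o' /(isometric_injective fiso)/uinj.
  have fucnd : cnd (fun o o' => `|f (u o) - f (u o')| `^ p).
    move=> v /(negative_type_cnd Xneg uinj); congr (_ <= _).
    by apply: eq_bigr => o _; apply: eq_bigr => o' _; rewrite fiso.
  apply: (affinely_independent p2 fuinj fucnd _ _ (Some i) (c := d)).
    by rewrite sum_option addNr.
  rewrite sum_option/= scaleNr scaler_suml addrC -sumrB -[RHS]cx.
  by apply: eq_bigr => j _; rewrite scalerBr.
- exact: Bspan.
have psi_le : [set: psi] #<= [set: sigma].
  rewrite -(card_le_eql Xpsi) -(card_le_eqr Bsigma).
  rewrite -(card_le_eql (inj_card_eq (f := g) _)); last by move=> x y _ _ /ginj.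
  by apply: subset_card_le => _ [x _ <-].
move/negP : sigma_neq; apply.
by rewrite card_eq_le sigma_le.
Qed.

End HardSpaces.

Theorem theorem5p6 (R : realType) (psi : Type) :
  infinite_set [set: psi] ->
  (forall X : metricType R, hard psi X ->
     exists E : euclideanType R, algebraic_dimension E psi /\
       exists f : X -> E, isometric_embedding f /\ closed (range f)) /\
  (forall X : metricType R, hard psi X ->
     forall sigma : Type, card_lt sigma psi ->
     forall F : euclideanType R, algebraic_dimension F sigma ->
     ~ exists f : X -> F, isometric_embedding f).
Proof.
move=> _; split=> X Xhard; first exact: hard_closed_embedding.
by move=> sigma lt_sigma F dimF; exact: hard_no_embedding Xhard _ _ lt_sigma dimF.
Qed.
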